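(* Let $P_1,\dots,P_n$ be discrete probability measures on $\mathbb{R}^d$ with weights $\lambda_1,\dots,\lambda_n>0$, $\sum_i\lambda_i=1$, such that every support point $\mathbf{x}_{ik}$ of every $P_i$ satisfies $\mathbf{x}_{ik}>0$ componentwise. Let $S^*$ be the set of all combinations of their support points. Let a set of possible combinations $S_0^*\subseteq S^*$ be given, together with an optimal fixed-support approximation of the barycenter problem over $S_0^*$ (an optimal solution of the restricted barycenter linear program over $S_0^*$), and let $y=(y_{ik})$ be the corresponding dual vector. In the variables $z_{ik}$ ($1\le i\le n$, $1\le k\le |P_i|$) and $z_{ijkm}$ ($1\le i<j\le n$, $1\le k\le|P_i|$, $1\le m\le|P_j|$), put $$f(\mathbf{z})=\sum_{i=1}^n\sum_{k=1}^{|P_i|} y_{ik}z_{ik}-\sum_{i=1}^{n-1}\sum_{j=i+1}^n\sum_{k=1}^{|P_i|}\lambda_i\lambda_j\,\mathbf{x}_{ik}^T\mathbf{x}_{ik}\,z_{ik}-\sum_{i=1}^{n-1}\sum_{j=i+1}^n\sum_{m=1}^{|P_j|}\lambda_i\lambda_j\,\mathbf{x}_{jm}^T\mathbf{x}_{jm}\,z_{jm}+2\sum_{i=1}^{n-1}\sum_{j=i+1}^n\sum_{k=1}^{|P_i|}\sum_{m=1}^{|P_j|}\lambda_i\lambda_j\,\mathbf{x}_{ik}^T\mathbf{x}_{jm}\,z_{ijkm}.$$ (Gen-IP): maximize $f(\mathbf{z})$ subject to $\sum_{k}z_{ik}=1$ for all $i$; $z_{ijkm}\le z_{ik}$, $z_{ijkm}\le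 z_{jm}$, $z_{ijkm}\ge z_{ik}+z_{jm}-1$ for all $i<j$, $k$, $m$; and all $z_{ik},z_{ijkm}\in\{0,1\}$. (Gen-MIP): maximize $f(\mathbf{z})$ subject to $\sum_{k}z_{ik}=1$ for all $i$; $z_{ijkm}\le z_{ik}$, $z_{ijkm}\le z_{jm}$ for all $i<j$, $k$, $m$; all $z_{ik}\in\{0,1\}$; and $z_{ijkm}\in\mathbb{R}$. Then: (1) (Gen-MIP) finds a new combination of best reduced cost from the set of all combinations $S^*$. That is, for an optimal solution $\mathbf{z}$ of (Gen-MIP), letting $k_i$ be the unique index with $z_{ik_i}=1$, the combination $s_{h^*}=(\mathbf{x}_{1k_1},\dots,\mathbf{x}_{nk_n})\in S^*$ is new, i.e. $s_{h^*}\notin S_0^*$, and satisfies $y^TA_{h^*}-c_{h^*}=\max_{s_h\in S^*}(y^TA_h-c_h)$. (2) The sets of optimal solutions $\mathbf{z}^*$ of (Gen-IP) and of (Gen-MIP) are identical.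
   Context: Each $P_i$ is a probability measure on $\mathbb{R}^d$ with finitely many support points $\mathbf{x}_{i1},\dots,\mathbf{x}_{i|P_i|}$ (distinct), where $|P_i|$ is the number of support points; the mass at $\mathbf{x}_{ik}$ is $d_{ik}>0$ and $\sum_k d_{ik}=1$. A combination is a tuple $s_h=(\mathbf{x}_1^h,\dots,\mathbf{x}_n^h)$ choosing one support point $\mathbf{x}_i^h$ of $P_i$ for each $i$. The set $S^*$ of all combinations has $\prod_{i=1}^n|P_i|$ elements. The unit transport cost of $s_h$ is $$c_h=\sum_{i=1}^{n-1}\lambda_i\sum_{j=i+1}^n\lambda_j\|\mathbf{x}_i^h-\mathbf{x}_j^h\|^2 .$$ Let $A_h$ be the $0,1$-vector indexed by pairs $(i,k)$, $1\le i\le n$, $1\le k\le|P_i|$, with entry $1$ at $(i,k)$ if and only if $\mathbf{x}_i^h=\mathbf{x}_{ik}$. The restricted barycenter linear program (fixed-support approximation) over $S_0^*\subseteq S^*$ is $$\min\sum_{s_h\in S_0^*}c_hw_h\quad\text{s.t.}\quad\sum_{s_h\in S_0^*}A_hw_h=(d_{ik}),\quad w_h\ge0 .$$ The dual vector $y=(y_{ik})$ is an optimal solution of its linear programming dual: maximize $\sum_{i,k}d_{ik}y_{ik}$ subject to $y^TA_h\le c_h$ for all $s_h\in S_0^*$, $y$ free. The reduced cost of $s_h$ is $c_h-y^TA_h$; best reduced cost means that $c_h-y^TA_h$ is minimal, equivalently $y^TA_h-c_h$ is maximal.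
   Formalization: That the combination is new (not in S_0^* ) is claimed only if some combination in S^* has negative reduced cost; otherwise it fails, e.g. for n=1 and a single support point, where S_0^*=S^*. Also d≥1 is assumed. *)

(* Defs.v *)
From mathcomp Require Import all_boot all_order all_algebra.
From mathcomp Require Import reals.

Set Implicit Arguments.
Unset Strict Implicit.
Unset Printing Implicit Defensive.

Import Order.TTheory GRing.Theory Num.Theory.
Local Open Scope ring_scope.

Definition dot (R : realType) (d : nat) (x y : 'cV[R]_d) : R :=
  (x^T *m y) 0 0.

(* The norm of normedtype on matrices is the sup norm, hence this definition. *)
Definition enorm (R : realType) (d : nat) (x : 'cV[R]_d) : R :=
  Num.sqrt (dot x x).

(* A finitely supported probability measure on R^d, presented by its distinct
   atoms and their masses. *)
Record discrete_measure (R : realType) (d : nat) := DiscreteMeasure {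
  supp_size : nat;
  point : 'I_supp_size -> 'cV[R]_d;
  mass : 'I_supp_size -> R;
  point_inj : injective point;
  mass_gt0 : forall k, 0 < mass k;
  mass_sum1 : \sum_k mass k = 1
}.

Definition is_maximizer (R : realType) (T : Type)
    (feasible : T -> Prop) (obj : T -> R) (x : T) : Prop :=
  feasible x /\ (forall x', feasible x' -> obj x' <= obj x).

Definition is_minimizer (R : realType) (T : Type)
    (feasible : T -> Prop) (obj : T -> R) (x : T) : Prop :=
  feasible x /\ (forall x', feasible x' -> obj x <= obj x').

Section Barycenter.

Variables (R : realType) (d n : nat).
Variables (P : 'I_n -> discrete_measure R d) (lambda : 'I_n -> R).

(* A combination is encoded by the indices of its support points; the atoms of
   each measure being distinct, this is the same as the tuple of points. *)
Definition combination := {dffun forall i : 'I_n, 'I_(supp_size (P i))}.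

Definition comb_point (s : combination) (i : 'I_n) : 'cV[R]_d :=
  point (s i).

Definition all_combinations : {set combination} := [set: combination].

Definition comb_cost (s : combination) : R :=
  \sum_(i < n) lambda i *
    \sum_(j < n | (i < j)%N)
      lambda j * enorm (comb_point s i - comb_point s j) ^+ 2.

(* Vectors indexed by the pairs (i, k), such as the columns of the linear
   program, its right-hand side and the dual vector. *)
Definition supp_vector := forall i : 'I_n, 'I_(supp_size (P i)) -> R.

Definition comb_column (s : combination) : supp_vector :=
  fun i k => (comb_point s i == point k)%:R.
Arguments comb_column : clear implicits.

Definition masses : supp_vector := fun i k => mass k.
Arguments masses : clear implicits.

Definition supp_dot (u v : supp_vector) : R := \sum_(i < n) \sum_k u i k * v i k.

(* Only the values of w on S0 are variables of the program; the others occur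
   neither in the constraints nor in the objective. *)
Definition primal_feasible (S0 : {set combination}) (w : combination -> R) :
    Prop :=
  (forall i k, \sum_(s in S0) comb_column s i k * w s = masses i k) /\
  (forall s, s \in S0 -> 0 <= w s).

Definition primal_optimal (S0 : {set combination}) : (combination -> R) -> Prop :=
  is_minimizer (primal_feasible S0) (fun w => \sum_(s in S0) comb_cost s * w s).

Definition dual_feasible (S0 : {set combination}) (y : supp_vector) : Prop :=
  forall s, s \in S0 -> supp_dot y (comb_column s) <= comb_cost s.

Definition dual_optimal (S0 : {set combination}) : supp_vector -> Prop :=
  is_maximizer (dual_feasible S0) (fun y => supp_dot masses y).

Definition reduced_cost (y : supp_vector) (s : combination) : R :=
  comb_cost s - supp_dot y (comb_column s).

(* zpair z i j k m is the variable z_{ijkm}. Only the entries with i < j are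
   variables of the programs; the others occur neither in the constraints nor
   in the objective. *)
Record variables := Variables {
  zsingle : forall i : 'I_n, 'I_(supp_size (P i)) -> R;
  zpair : forall i j : 'I_n, 'I_(supp_size (P i)) -> 'I_(supp_size (P j)) -> R
}.

Definition gen_objective (y : supp_vector) (z : variables) : R :=
  \sum_(i < n) \sum_k y i k * zsingle z k
  - \sum_(i < n) \sum_(j < n | (i < j)%N) \sum_(k < supp_size (P i))
      lambda i * lambda j * dot (point k) (point k) * zsingle z k
  - \sum_(i < n) \sum_(j < n | (i < j)%N) \sum_(m < supp_size (P j))
      lambda i * lambda j * dot (point m) (point m) * zsingle z m
  + 2 * \sum_(i < n) \sum_(j < n | (i < j)%N)
          \sum_(k < supp_size (P i)) \sum_(m < supp_size (P j))
            lambda i * lambda j * dot (point k) (point m) * zpair z k m.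

Definition gen_ip_feasible (z : variables) : Prop :=
  [/\ forall i : 'I_n, \sum_(k < supp_size (P i)) zsingle z k = 1,
      forall (i j : 'I_n) (k : 'I_(supp_size (P i)))
             (m : 'I_(supp_size (P j))), (i < j)%N ->
        [/\ zpair z k m <= zsingle z k,
            zpair z k m <= zsingle z m &
            zpair z k m >= zsingle z k + zsingle z m - 1],
      forall (i : 'I_n) (k : 'I_(supp_size (P i))),
        zsingle z k = 0 \/ zsingle z k = 1 &
      forall (i j : 'I_n) (k : 'I_(supp_size (P i)))
             (m : 'I_(supp_size (P j))), (i < j)%N ->
        zpair z k m = 0 \/ zpair z k m = 1].

Definition gen_mip_feasible (z : variables) : Prop :=
  [/\ forall i : 'I_n, \sum_(k < supp_size (P i)) zsingle z k = 1,
      forall (i j : 'I_n) (k : 'I_(supp_size (P i)))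
             (m : 'I_(supp_size (P j))), (i < j)%N ->
        zpair z k m <= zsingle z k /\ zpair z k m <= zsingle z m &
      forall (i : 'I_n) (k : 'I_(supp_size (P i))),
        zsingle z k = 0 \/ zsingle z k = 1].

Definition gen_ip_optimal (y : supp_vector) : variables -> Prop :=
  is_maximizer gen_ip_feasible (gen_objective y).

Definition gen_mip_optimal (y : supp_vector) : variables -> Prop :=
  is_maximizer gen_mip_feasible (gen_objective y).

End Barycenter.

Arguments comb_column {R d n P} s i k.
Arguments masses {R d n} P i k.

(* Main.v *)
Require Import Defs.
From mathcomp Require Import all_boot all_order all_algebra.
From mathcomp Require Import reals.
From mathcomp Require Import ring lra.

Set Implicit Arguments.
Unset Strict Implicit.
Unset Printing Implicit Defensive.

Import Order.TTheory GRing.Theory Num.Theory.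
Local Open Scope ring_scope.

(** The feasible 0-1 vectors (z_{ik}) are exactly the indicators of the
    combinations. For a fixed combination s, the objective is nondecreasing in
    each z_{ijkm}, with coefficient 2 lambda_i lambda_j x_{ik}^T x_{jm} > 0, so
    at an optimum each z_{ijkm} reaches its upper bound min(z_{ik}, z_{jm}).
    This bound is z_{ik} z_{jm}, which is integral and satisfies the remaining
    constraint of (Gen-IP). At that point, expanding the squared distances
    shows that the objective is y^T A_s - c_s. A combination of S0 has
    nonnegative reduced cost by dual feasibility, so it cannot be optimal as
    soon as some combination has negative reduced cost. *)

Section Dot.

Variables (R : realType) (d : nat).
Implicit Types x y : 'cV[R]_d.

Lemma dotE x y : dot x y = \sum_c x c 0 * y c 0.
Proof. by rewrite /dot mxE; apply: eq_bigr => c _; rewrite mxE. Qed.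

(** In dimension 0 the dot product is an empty sum; otherwise coordinate 0 already contributes a
    positive term. *)
Lemma dot_gt0 x y : (0 < d)%N -> (forall c, 0 < x c 0) ->
  (forall c, 0 < y c 0) -> 0 < dot x y.
Proof.
move=> d_gt0 x_gt0 y_gt0; rewrite dotE (bigD1 (Ordinal d_gt0)) //=.
by rewrite ltr_wpDr ?mulr_gt0 ?sumr_ge0 // => c _; rewrite ltW ?mulr_gt0.
Qed.

Lemma enorm_sqr x : enorm x ^+ 2 = dot x x.
Proof.
by rewrite sqr_sqrtr // dotE sumr_ge0 // => c _; rewrite -expr2 sqr_ge0.
Qed.

Lemma enorm_sqrB x y :
  enorm (x - y) ^+ 2 = dot x x + dot y y - 2 * dot x y.
Proof.
rewrite enorm_sqr !dotE mulr_sumr -big_split -sumrB /=.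
by apply: eq_bigr => c _; rewrite !mxE; ring.
Qed.

End Dot.

Lemma sum_mul_delta (R : pzSemiRingType) (I : finType) (F : I -> R) (i : I) :
  \sum_j F j * (j == i)%:R = F i.
Proof.
by under eq_bigr do rewrite mulr_natr mulrb; rewrite -big_mkcond big_pred1_eq.
Qed.

(** If no value were 1, all would be 0, and so would the sum. *)
Lemma sum01_delta (R : numDomainType) (I : finType) (F : I -> R) :
  (forall i, F i = 0 \/ F i = 1) -> \sum_i F i = 1 ->
  exists i, forall j, F j = (j == i)%:R.
Proof.
move=> F01 F_sum1.
have F_ge0 j : 0 <= F j by case: (F01 j) => ->.
have [i Fi1] : exists i, F i = 1.
  case: (pickP (fun i => F i == 1)) => [i /eqP|F_neq1]; first by exists i.
  have /esym/eqP := F_sum1; rewrite big1 ?oner_eq0 // => i _.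
  by case: (F01 i) => // /eqP; rewrite F_neq1.
exists i => j; case: (eqVneq j i) => [->//|j_neq_i].
(* The terms other than [F i] are nonnegative, and cancelling [F i = 1] from the total leaves them
   with sum 0. *)
apply: (@psumr_eq0P _ _ (fun j => j != i) F) => //.
by apply: (addrI 1); rewrite addr0 -[RHS]F_sum1 [RHS](bigD1 i) //= Fi1.
Qed.

Section Programs.

Variables (R : realType) (d n : nat).
Variables (P : 'I_n -> discrete_measure R d) (lambda : 'I_n -> R).
Variable y : supp_vector P.
Implicit Types (s : combination P) (z : variables P).

(** On indicators the product is the minimum of its factors, hence the largest value that the upper
    bounds on z_{ijkm} allow. *)
Definition comb_variables s : variables P :=
  Variables (fun i k => (k == s i)%:R)
            (fun i j k m => (k == s i)%:R * (m == s j)%:R).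

(** The z_{ijkm} stay free, so that this also covers points of (Gen-MIP) that are not integral. *)
Definition selects z s :=
  forall i (k : 'I_(supp_size (P i))), zsingle z k = (k == s i)%:R.

Lemma comb_columnE s i (k : 'I_(supp_size (P i))) :
  comb_column s i k = (k == s i)%:R.
Proof.
by rewrite /comb_column /comb_point eq_sym (inj_eq (@point_inj _ _ (P i))).
Qed.

Lemma gen_objective_comb s :
  gen_objective lambda y (comb_variables s) =
  supp_dot y (comb_column s) - comb_cost lambda s.
Proof.
rewrite /gen_objective /supp_dot /comb_cost /=.
under [in RHS]eq_bigr do under eq_bigr do rewrite comb_columnE.
(* The terms in [y] agree; the rest is compared pair by pair over i < j. *)
rewrite -!addrA; congr (_ + _).
rewrite mulr_sumr -!sumrN -!big_split /=; apply: eq_bigr => i _.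
rewrite !mulr_sumr -!sumrN -!big_split /=; apply: eq_bigr => j _.
have -> : \sum_k \sum_m lambda i * lambda j * dot (point k) (point m) *
      ((k == s i)%:R * (m == s j)%:R) =
    lambda i * lambda j * dot (point (s i)) (point (s j)).
  under eq_bigr => k _.
    under eq_bigr do rewrite mulrCA mulrC.
    rewrite -mulr_suml.
    rewrite (sum_mul_delta
      (fun m => lambda i * lambda j * dot (point k) (point m)) (s j)).
  over.
  exact: (sum_mul_delta
    (fun k => lambda i * lambda j * dot (point k) (point (s j)))).
rewrite (sum_mul_delta
  (fun k => lambda i * lambda j * dot (point k) (point k)) (s i)).
rewrite (sum_mul_delta
  (fun m => lambda i * lambda j * dot (point m) (point m)) (s j)).
by rewrite enorm_sqrB /comb_point; ring.
Qed.

(** The entries of [zpair] with i >= j are left arbitrary, since optimality says nothing about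
    them. *)
Lemma gen_ip_feasible_pair_eq z s :
  selects z s ->
  (forall (i j : 'I_n) (k : 'I_(supp_size (P i))) (m : 'I_(supp_size (P j))),
     (i < j)%N -> zpair z k m = (k == s i)%:R * (m == s j)%:R) ->
  gen_ip_feasible z.
Proof.
move=> zE zpE; split.
- move=> i; under eq_bigr do rewrite zE -[_%:R]mul1r.
  exact: (sum_mul_delta (fun=> 1)).
- move=> i j k m ij; rewrite !zE zpE //.
  by case: (k == s i); case: (m == s j); split; rewrite /=; lra.
- by move=> i k; rewrite zE; case: eqP; [right|left].
- move=> i j k m ij; rewrite zpE //.
  by case: (k == s i); case: (m == s j); rewrite /= ?mulr1 ?mulr0;
    [right|left..].
Qed.

Lemma gen_ip_feasible_comb s : gen_ip_feasible (comb_variables s).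
Proof. exact: (@gen_ip_feasible_pair_eq _ s). Qed.

Lemma gen_ip_mip_feasible z : gen_ip_feasible z -> gen_mip_feasible z.
Proof.
by case=> zsum zle z01 _; split=> // i j k m /(zle _ _ k m)[].
Qed.

Lemma gen_mip_feasible_selects z :
  gen_mip_feasible z -> exists s, selects z s.
Proof.
case=> zsum _ z01.
have /fin_all_exists [f fE] i := sum01_delta (z01 i) (zsum i).
by exists [ffun i => f i] => i k; rewrite ffunE.
Qed.

Hypotheses (d_gt0 : (0 < d)%N) (lambda_gt0 : forall i, 0 < lambda i).
Hypothesis points_gt0 :
  forall i (k : 'I_(supp_size (P i))) (c : 'I_d), 0 < point k c 0.

Lemma pair_coef_gt0 i j (k : 'I_(supp_size (P i))) (m : 'I_(supp_size (P j))) :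
  0 < lambda i * lambda j * dot (point k) (point m).
Proof. by rewrite !mulr_gt0 ?dot_gt0. Qed.

(** The equality case serves to determine the z_{ijkm} at an optimum: a sum of termwise inequalities
    is tight only if each of them is. *)
Lemma gen_objective_leif z s : gen_mip_feasible z -> selects z s ->
  gen_objective lambda y z <= gen_objective lambda y (comb_variables s)
    ?= iff [forall i : 'I_n, forall (j : 'I_n | (i < j)%N),
              forall k : 'I_(supp_size (P i)), forall m : 'I_(supp_size (P j)),
              zpair z k m == (k == s i)%:R * (m == s j)%:R].
Proof.
case=> _ zle _ zE; rewrite /gen_objective /=.
(* Both sides have the same z_{ik}, so only the sums over the z_{ijkm} differ. *)
under eq_bigr do under eq_bigr do rewrite zE.
under [X in _ - X - _ + _]eq_bigr do under eq_bigr do under eq_bigr do rewrite zE.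
under [X in _ - _ - X + _]eq_bigr do under eq_bigr do under eq_bigr do rewrite zE.
rewrite (mono_leif (lerD2l _)) (mono_leif (ler_pM2l _)) ?ltr0n //.
apply: leif_sum => i _; apply: leif_sum => j ij.
apply: leif_sum => k _; apply: leif_sum => m _.
(* Strict positivity of the coefficient preserves the equality case. *)
rewrite (mono_leif (ler_pM2l (pair_coef_gt0 _ _))); apply/leif_eq.
have [] := zle i j k m ij; rewrite !zE.
(* If k is selected, the bound by z_{jm} gives the claim; otherwise the bound by z_{ik} = 0 does. *)
by case: (k == s i); rewrite /= ?mul1r ?mul0r.
Qed.

Lemma le_gen_objective_comb z s : gen_mip_feasible z -> selects z s ->
  gen_objective lambda y z <= gen_objective lambda y (comb_variables s).
Proof. by move=> zf zs; case: (gen_objective_leif zf zs). Qed.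

Lemma gen_mip_optimal_objective z s : gen_mip_optimal lambda y z ->
  selects z s ->
  gen_objective lambda y z = gen_objective lambda y (comb_variables s).
Proof.
case=> zf zmax zs; apply/le_anti; rewrite le_gen_objective_comb //=.
exact/zmax/gen_ip_mip_feasible/gen_ip_feasible_comb.
Qed.

(** Optimality turns the inequality of [gen_objective_leif] into an equality, so its condition holds
    and makes each z_{ijkm} with i < j a product of indicators. *)
Lemma gen_mip_optimal_ip_feasible z :
  gen_mip_optimal lambda y z -> gen_ip_feasible z.
Proof.
move=> zopt; have [zf _] := zopt; have [s zs] := gen_mip_feasible_selects zf.
have [_] := gen_objective_leif zf zs.
rewrite (gen_mip_optimal_objective zopt zs) eqxx => /esym zpE.
apply: (gen_ip_feasible_pair_eq zs) => i j k m ij.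
by move: zpE => /forallP/(_ i)/forallP/(_ j)/implyP/(_ ij)/forallP/(_ k)
  /forallP/(_ m)/eqP.
Qed.

Lemma gen_ip_mip_optimal z :
  gen_ip_optimal lambda y z <-> gen_mip_optimal lambda y z.
Proof.
split=> [[zf zmax]|zopt].
  split=> [|z' z'f]; first exact: gen_ip_mip_feasible.
  (* A rival [z'] is dominated by the indicator point of its combination, which is feasible for
     (Gen-IP). *)
  have [s z's] := gen_mip_feasible_selects z'f.
  exact: le_trans (le_gen_objective_comb z'f z's)
    (zmax _ (gen_ip_feasible_comb s)).
split; first exact: gen_mip_optimal_ip_feasible.
by move=> z' /gen_ip_mip_feasible; case: zopt => _; apply.
Qed.

Lemma gen_mip_optimal_max z s s' : gen_mip_optimal lambda y z ->
  selects z s ->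
  supp_dot y (comb_column s') - comb_cost lambda s' <=
  supp_dot y (comb_column s) - comb_cost lambda s.
Proof.
move=> zopt zs; rewrite -!gen_objective_comb.
rewrite -(gen_mip_optimal_objective zopt zs).
by case: zopt => _; apply; apply/gen_ip_mip_feasible/gen_ip_feasible_comb.
Qed.

End Programs.

Theorem theorem2 (R : realType) (d n : nat)
    (P : 'I_n -> discrete_measure R d) (lambda : 'I_n -> R)
    (S0 : {set combination P}) (w : combination P -> R) (y : supp_vector P)
    (d_gt0 : (0 < d)%N)
    (lambda_gt0 : forall i : 'I_n, 0 < lambda i)
    (lambda_sum1 : \sum_(i < n) lambda i = 1)
    (points_gt0 : forall (i : 'I_n) (k : 'I_(supp_size (P i))) (c : 'I_d),
       0 < point k c 0)
    (w_opt : primal_optimal lambda S0 w)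
    (y_opt : dual_optimal lambda S0 y) :
  (forall z : variables P, gen_mip_optimal lambda y z ->
     exists s : combination P,
       [/\ forall (i : 'I_n) (k : 'I_(supp_size (P i))),
             zsingle z k = 1 <-> k = s i,
           (exists2 s' : combination P,
              s' \in all_combinations P & reduced_cost lambda y s' < 0) ->
             s \notin S0 &
           is_maximizer (fun s' : combination P => s' \in all_combinations P)
             (fun s' => supp_dot y (comb_column s') - comb_cost lambda s') s]) /\
  (forall z : variables P,
     gen_ip_optimal lambda y z <-> gen_mip_optimal lambda y z).
Proof.
split=> [z zopt|z]; last exact: gen_ip_mip_optimal.
have [zf _] := zopt; have [s zs] := gen_mip_feasible_selects zf.
have s_max s' := gen_mip_optimal_max d_gt0 lambda_gt0 points_gt0 s' zopt zs.
exists s; split.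
- move=> i k; rewrite zs; split=> [/eqP|->]; last by rewrite eqxx.
  by rewrite pnatr_eq1 eqb1 => /eqP.
(* Since [s] is at least as good as [s'], its reduced cost is negative too, which violates the dual
   constraint of [s] if [s] lies in [S0]. *)
- case=> s' _; rewrite /reduced_cost subr_lt0 => s'_lt; apply/negP => sS0.
  have [/(_ s sS0) + _] := y_opt; apply/negP; rewrite -ltNge -subr_gt0.
  by apply: lt_le_trans (s_max s'); rewrite subr_gt0.
- by split; [rewrite inE|move=> s' _; apply: s_max].
Qed.
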